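(* Let $\mathbf{Q}$ be a quantale, $\mathbf{M}$ and $\mathbf{N}$ left $\mathbf{Q}$-modules, $X$ and $Y$ sets, and $\pi:\mathbf{Q}^X\to\mathbf{M}$, $\pi':\mathbf{Q}^Y\to\mathbf{N}$ surjective homomorphisms. Then for every homomorphism $h:\mathbf{M}\to\mathbf{N}$ there exists $k\in Q^{X\times Y}$ such that $h\circ\pi=\pi'\circ H_k$, where $H_k:Q^X\to Q^Y$ is defined by $H_kf(y)=\bigvee_{x\in X}f(x)\cdot k(x,y)$.
   Context: A quantale is $\mathbf{Q}=\langle Q,\vee,\cdot,\bot,e\rangle$ with $\langle Q,\vee,\bot\rangle$ a complete lattice, $\langle Q,\cdot,e\rangle$ a monoid, and multiplication distributing over arbitrary joins on both sides. A left $\mathbf{Q}$-module is a complete lattice $\langle M,\vee,\bot\rangle$ with an action $\star:Q\times M\to M$ satisfying $(q_1q_2)\star m=q_1\star(q_2\star m)$, $e\star m=m$, and distributing over arbitrary joins in each argument; homomorphisms preserve arbitrary joins and the action. For a set $Z$, $\mathbf{Q}^Z$ is the module of maps $Z\to Q$ with pointwise joins and action $(q\star f)(z)=q\cdot f(z)$. *)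

(* Defs.v *)
From HB Require Import structures.
From mathcomp Require Import all_boot all_order.
From mathcomp Require Import boolp classical_sets functions.

Set Implicit Arguments.
Unset Strict Implicit.
Unset Printing Implicit Defensive.

Local Open Scope classical_set_scope.
Local Open Scope group_scope.

(* The bottom element is csup set0; binary joins, the top element and arbitrary
   meets are likewise determined by csup. *)
HB.mixin Record POrder_isCompleteLattice (d : Order.disp_t) L
    of Order.POrder d L := {
  csup : set L -> L;
  csupP : forall A : set L, isLub A (csup A)
}.

#[short(type="completeLatticeType")]
HB.structure Definition CompleteLattice (d : Order.disp_t) :=
  {L of Order.POrder d L & POrder_isCompleteLattice d L}.

HB.mixin Record CompleteLattice_isQuantale (d : Order.disp_t) Q
    of CompleteLattice d Q & monoid.Monoid Q := {
  qmul_csupr : forall (q : Q) (A : set Q),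
    q * csup A = csup [set q * a | a in A];
  qmul_csupl : forall (A : set Q) (q : Q),
    csup A * q = csup [set a * q | a in A]
}.

#[short(type="quantaleType")]
HB.structure Definition Quantale (d : Order.disp_t) :=
  {Q of CompleteLattice d Q & monoid.Monoid Q & CompleteLattice_isQuantale d Q}.

HB.mixin Record CompleteLattice_isQModule (dQ : Order.disp_t)
    (Q : quantaleType dQ) (d : Order.disp_t) M of CompleteLattice d M := {
  qact : Q -> M -> M;
  qactM : forall (q1 q2 : Q) (m : M), qact (q1 * q2) m = qact q1 (qact q2 m);
  qact1 : forall m : M, qact 1 m = m;
  qact_csupr : forall (q : Q) (A : set M),
    qact q (csup A) = csup [set qact q m | m in A];
  qact_csupl : forall (A : set Q) (m : M),
    qact (csup A) m = csup [set qact q m | q in A]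
}.

#[short(type="qmoduleType")]
HB.structure Definition QModule (dQ : Order.disp_t) (Q : quantaleType dQ)
    (d : Order.disp_t) :=
  {M of CompleteLattice d M & CompleteLattice_isQModule dQ Q d M}.

Record qmodule_hom (dQ : Order.disp_t) (Q : quantaleType dQ)
    (dM : Order.disp_t) (M : qmoduleType Q dM)
    (dN : Order.disp_t) (N : qmoduleType Q dN) (h : M -> N) : Prop := {
  qmodule_hom_csup : forall A : set M, h (csup A) = csup [set h m | m in A];
  qmodule_hom_act : forall (q : Q) (m : M), h (qact q m) = qact q (h m)
}.

(* Functions carry the library's pointwise order, so the joins below are forced;
   this makes Z -> Q the module Q^Z. *)
Section FunCompleteLattice.
Variables (Z : Type) (d : Order.disp_t) (L : completeLatticeType d).

Definition fun_csup (F : set (Z -> L)) : Z -> L :=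
  fun z => csup [set f z | f in F].

Lemma fun_csupP (F : set (Z -> L)) : isLub F (fun_csup F).
Proof.
split=> [f Ff|g ubg]; apply/lefP => z.
  by apply: (csupP [set f z | f in F]).1; exists f.
by apply: (csupP [set f z | f in F]).2 => _ [f Ff <-]; move/lefP: (ubg f Ff).
Qed.

HB.instance Definition _ :=
  POrder_isCompleteLattice.Build _ (Z -> L) fun_csupP.

End FunCompleteLattice.

Section FunQModule.
Variables (Z : Type) (d : Order.disp_t) (Q : quantaleType d).

Definition fun_qact (q : Q) (f : Z -> Q) : Z -> Q := fun z => q * f z.

Lemma fun_qactM (q1 q2 : Q) (f : Z -> Q) :
  fun_qact (q1 * q2) f = fun_qact q1 (fun_qact q2 f).
Proof. by apply/funext => z; rewrite /fun_qact mulgA. Qed.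

Lemma fun_qact1 (f : Z -> Q) : fun_qact 1 f = f.
Proof. by apply/funext => z; rewrite /fun_qact mul1g. Qed.

Lemma fun_qact_csupr (q : Q) (F : set (Z -> Q)) :
  fun_qact q (csup F) = csup [set fun_qact q f | f in F].
Proof.
apply/funext => z; rewrite /fun_qact /csup /= /fun_csup qmul_csupr.
by rewrite !image_comp.
Qed.

Lemma fun_qact_csupl (A : set Q) (f : Z -> Q) :
  fun_qact (csup A) f = csup [set fun_qact q f | q in A].
Proof.
apply/funext => z; rewrite /fun_qact qmul_csupl.
by rewrite [RHS]/csup /= /fun_csup image_comp.
Qed.

HB.instance Definition _ :=
  CompleteLattice_isQModule.Build d Q _ (Z -> Q)
    fun_qactM fun_qact1 fun_qact_csupr fun_qact_csupl.

End FunQModule.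

Definition kernel_map (d : Order.disp_t) (Q : quantaleType d) (X Y : Type)
    (k : X * Y -> Q) (f : X -> Q) : Y -> Q :=
  fun y => csup [set f x * k (x, y) | x in [set: X]].

(* Main.v *)
Require Import Defs.
From HB Require Import structures.
From mathcomp Require Import all_boot all_order.
From mathcomp Require Import boolp classical_sets functions.

(** The point masses [qdelta x] generate [Q^X]: every [f] is the join of the
    [f x * qdelta x].  Surjectivity of [pi'] and choice give [g x] with
    [pi' (g x) = h (pi (qdelta x))]; since [H_k f] is the join of the
    [f x * g x] for [k (x, y) = g x y], the homomorphisms [h \o pi] and
    [pi' \o H_k] agree. *)

Local Open Scope classical_set_scope.

Lemma csup_eq {d : Order.disp_t} {L : completeLatticeType d} {A : set L}
    {s : L} :
  isLub A s -> csup A = s.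
Proof.
move=> [ubs lubs]; have [ubA lubA] := csupP A.
by apply: Order.le_anti; rewrite lubA //= lubs.
Qed.

(** The bottom is the join of the empty set, so this is distributivity over an empty join. *)
Lemma qmulg_bot {d : Order.disp_t} {Q : quantaleType d} (q : Q) :
  (q * csup set0)%g = csup set0.
Proof. by rewrite qmul_csupr image_set0. Qed.

(** [csup set0] is the bottom; equality is decided classically because [X] is an arbitrary type. *)
Definition qdelta {d : Order.disp_t} (Q : quantaleType d) {X : Type} (x : X) :
    X -> Q :=
  fun z => if `[< x = z >] then 1%g else csup set0.

(** At a point [z] the term with [x = z] is [f z * 1] and every other term is bottom. *)
Lemma csup_qdelta {d : Order.disp_t} {Q : quantaleType d} {X : Type}
    (f : X -> Q) :
  csup [set qact (f x) (qdelta Q x) | x in [set: X]] = f.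
Proof.
apply/funext => z; rewrite [LHS]/csup /= /fun_csup image_comp.
apply: csup_eq; split=> [_ [x _ <-]|u ubu].
- rewrite /= /qact /= /fun_qact /qdelta.
  case: asboolP => [->|_]; first by rewrite mulg1.
  by rewrite qmulg_bot; apply: (csupP set0).2.
- apply: ubu; exists z => //=.
  by rewrite /qact /= /fun_qact /qdelta asboolT // mulg1.
Qed.

(** Joins and action on [Y -> Q] are pointwise. In this form, a combination of the rows of [k], a
    homomorphism can be applied term by term. *)
Lemma kernel_map_csup {d : Order.disp_t} {Q : quantaleType d} {X Y : Type}
    (k : X * Y -> Q) (f : X -> Q) :
  kernel_map k f = csup [set qact (f x) (fun y => k (x, y)) | x in [set: X]].
Proof.
by apply/funext => y; rewrite [RHS]/csup /= /fun_csup image_comp.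
Qed.

Lemma qmodule_hom_comp {dQ dM dN dP : Order.disp_t} {Q : quantaleType dQ}
    {M : qmoduleType Q dM} {N : qmoduleType Q dN} {P : qmoduleType Q dP}
    {g : M -> N} {h : N -> P} :
  qmodule_hom g -> qmodule_hom h -> qmodule_hom (h \o g).
Proof.
move=> [gS gA] [hS hA]; split=> [A|q m] /=; last by rewrite gA hA.
by rewrite gS hS image_comp.
Qed.

Lemma qmodule_hom_csup_act {dQ dM dN : Order.disp_t} {Q : quantaleType dQ}
    {M : qmoduleType Q dM} {N : qmoduleType Q dN} {h : M -> N} {I : Type}
    (q : I -> Q) (m : I -> M) :
  qmodule_hom h ->
  h (csup [set qact (q i) (m i) | i in [set: I]]) =
  csup [set qact (q i) (h (m i)) | i in [set: I]].
Proof.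
move=> [hS hA]; rewrite hS image_comp; congr csup.
by apply: eq_imagel => i _ /=; rewrite hA.
Qed.

Theorem theorem5p20 (dQ dM dN : Order.disp_t) (Q : quantaleType dQ)
    (M : qmoduleType Q dM) (N : qmoduleType Q dN) (X Y : Type)
    (pi : (X -> Q) -> M) (pi' : (Y -> Q) -> N)
    (pi_hom : qmodule_hom pi) (pi_surj : set_surj setT setT pi)
    (pi'_hom : qmodule_hom pi') (pi'_surj : set_surj setT setT pi')
    (h : M -> N) (h_hom : qmodule_hom h) :
  exists k : X * Y -> Q, h \o pi = pi' \o kernel_map k.
Proof.
have hpi_hom := qmodule_hom_comp pi_hom h_hom.
have /choice[g pi'g] x : exists g : Y -> Q, pi' g = h (pi (qdelta Q x)).
  by have [g _ gx] := pi'_surj (h (pi (qdelta Q x))) I; exists g.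
exists (fun p => g p.1 p.2); apply/funext => f.
(* Only the [f] on the left is expanded into point masses. Both sides then become joins over [x] of
   [f x] acting on elements of [N], which [pi'g] identifies termwise. *)
rewrite -{1}(csup_qdelta f) (qmodule_hom_csup_act _ _ hpi_hom) /=.
rewrite kernel_map_csup (qmodule_hom_csup_act _ _ pi'_hom).
by congr csup; apply: eq_imagel => x _; rewrite /= -pi'g.
Qed.
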